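(* Let $A$ and $B$ be abelian groups with $\operatorname{Ext}(A,\mathbb{Z})=0$ and $\operatorname{Ext}(B,\mathbb{Z})=0$. Then there are natural isomorphisms \[\operatorname{Ext}(A,B^{*})\cong \operatorname{Ext}(B,A^{*})\quad\text{and}\quad \operatorname{Ext}(A,B^{*})\cong \operatorname{Ext}(A\otimes B,\mathbb{Z}).\]
   Context: All groups are abelian. For an abelian group $G$, $G^{*}=\operatorname{Hom}(G,\mathbb{Z})$ denotes its dual. A group $G$ with $\operatorname{Ext}(G,\mathbb{Z})=0$ is called a Whitehead group (W-group). *)

(* Defs.v *)
From HB Require Import structures.
From mathcomp Require Import all_boot all_algebra generic_quotient ring_quotient.
From mathcomp Require Import boolp.
From mathcomp.multinomials Require Import freeg.

Set Implicit Arguments.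
Unset Strict Implicit.
Unset Printing Implicit Defensive.

Import GRing.Theory.
Local Open Scope ring_scope.
Local Open Scope quotient_scope.

Section HomGroup.
Variables A B : zmodType.
Implicit Types f g h : {additive A -> B}.

Lemma additive_ext f g : f =1 g -> f = g.
Proof.
case: f g => [f [[fP]]] [g [[gP]]] /= /funext fg; rewrite {}fg in fP *.
by rewrite (Prop_irrelevance fP gP).
Qed.

HB.instance Definition _ := gen_eqMixin {additive A -> B}.
HB.instance Definition _ := gen_choiceMixin {additive A -> B}.

Definition hom_zero : {additive A -> B} := \0.
Definition hom_opp f : {additive A -> B} := \- f.
Definition hom_add f g : {additive A -> B} := f \+ g.

Lemma hom_addA : associative hom_add.
Proof. by move=> f g h; apply: additive_ext => x /=; rewrite addrA. Qed.
Lemma hom_addC : commutative hom_add.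
Proof. by move=> f g; apply: additive_ext => x /=; rewrite addrC. Qed.
Lemma hom_add0 : left_id hom_zero hom_add.
Proof. by move=> f; apply: additive_ext => x /=; rewrite add0r. Qed.
Lemma hom_addN : left_inverse hom_zero hom_opp hom_add.
Proof. by move=> f; apply: additive_ext => x /=; rewrite addNr. Qed.

HB.instance Definition _ :=
  GRing.isZmodule.Build {additive A -> B} hom_addA hom_addC hom_add0 hom_addN.

Lemma hom_addE f g x : (f + g) x = f x + g x. Proof. by []. Qed.
Lemma hom_oppE f x : (- f) x = - f x. Proof. by []. Qed.
Lemma hom_subE f g x : (f - g) x = f x - g x. Proof. by []. Qed.
Lemma hom_zeroE x : (0 : {additive A -> B}) x = 0. Proof. by []. Qed.

End HomGroup.

Definition hom_id (A : zmodType) : {additive A -> A} := idfun.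

Definition hom_comp (A B C : zmodType)
  (g : {additive B -> C}) (f : {additive A -> B}) : {additive A -> C} := g \o f.

Section Precomposition.
Variables (A A' C : zmodType) (f : {additive A' -> A}).

Definition precomp_fun (u : {additive A -> C}) : {additive A' -> C} :=
  hom_comp u f.

Lemma precomp_additive : zmod_morphism precomp_fun.
Proof. by move=> u v; apply: additive_ext. Qed.

HB.instance Definition _ := GRing.isZmodMorphism.Build
  {additive A -> C} {additive A' -> C} precomp_fun precomp_additive.

Definition precomp : {additive {additive A -> C} -> {additive A' -> C}} :=
  precomp_fun.

End Precomposition.
Arguments precomp {A A'} C f.

Section Postcomposition.
Variables (A C C' : zmodType) (g : {additive C -> C'}).

Definition postcomp_fun (u : {additive A -> C}) : {additive A -> C'} :=
  hom_comp g u.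

Lemma postcomp_additive : zmod_morphism postcomp_fun.
Proof. by move=> u v; apply: additive_ext => x /=; rewrite raddfB. Qed.

HB.instance Definition _ := GRing.isZmodMorphism.Build
  {additive A -> C} {additive A -> C'} postcomp_fun postcomp_additive.

Definition postcomp : {additive {additive A -> C} -> {additive A -> C'}} :=
  postcomp_fun.

End Postcomposition.
Arguments postcomp A {C C'} g.

Definition dual (A : zmodType) : zmodType := {additive A -> int}.

Definition dual_map (A A' : zmodType) (f : {additive A' -> A}) :
  {additive dual A -> dual A'} := precomp int f.

Section QuotientLift.
Variables (V W : zmodType) (I : zmodClosed V).

Definition quot_proj : {additive V -> Quotient.quot I} := \pi.

Lemma quot_proj_eq0 x : (quot_proj x == 0) = (x \in I).
Proof. by rewrite -[0](raddf0 quot_proj) -Quotient.idealrBE subr0. Qed.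

Lemma quot_proj_surj (y : Quotient.quot I) : exists x, y = quot_proj x.
Proof. by exists (repr y); rewrite /quot_proj /= reprK. Qed.

Variables (h : {additive V -> W}) (hI : {in I, forall x, h x = 0}).

Definition quot_lift_fun of {in I, forall x, h x = 0} :=
  fun y : Quotient.quot I => h (repr y).

Lemma quot_lift_funE x : quot_lift_fun hI (quot_proj x) = h x.
Proof.
apply/eqP; rewrite -subr_eq0 -raddfB; apply/eqP/hI.
by rewrite Quotient.idealrBE reprK.
Qed.

Lemma quot_lift_additive : zmod_morphism (quot_lift_fun hI).
Proof.
move=> y z; have [u ->] := quot_proj_surj y; have [v ->] := quot_proj_surj z.
by rewrite -raddfB !quot_lift_funE raddfB.
Qed.

HB.instance Definition _ := GRing.isZmodMorphism.Build
  (Quotient.quot I) W (quot_lift_fun hI) quot_lift_additive.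

Definition quot_lift : {additive Quotient.quot I -> W} := quot_lift_fun hI.

Lemma quot_liftE x : quot_lift (quot_proj x) = h x.
Proof. exact: quot_lift_funE. Qed.

End QuotientLift.

Section Kernel.
Variables (V W : zmodType) (h : {additive V -> W}).

Definition kernel : {pred V} := [pred x | h x == 0].

Lemma kernel_closed : zmod_closed kernel.
Proof.
split=> [|x y]; rewrite !inE ?raddf0 // => /eqP hx /eqP hy.
by rewrite raddfB hx hy subr0.
Qed.
HB.instance Definition _ := GRing.isZmodClosed.Build V kernel kernel_closed.

Record ker := Ker { ker_val : V; _ : ker_val \in kernel }.

HB.instance Definition _ := [isSub for ker_val].
HB.instance Definition _ := [Choice of ker by <:].
HB.instance Definition _ := [SubChoice_isSubZmodule of ker by <:].

Definition ker_incl : {additive ker -> V} := val.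

Lemma ker_inclP (x : ker) : h (ker_incl x) = 0.
Proof. exact/eqP/(valP x). Qed.

End Kernel.

Section KernelMap.
Variables (V W V' W' : zmodType).
Variables (h : {additive V -> W}) (h' : {additive V' -> W'}).
Variables (a : {additive V -> V'}) (b : {additive W -> W'}).
Hypothesis ab : forall x, h' (a x) = b (h x).

Lemma ker_map_subproof (x : ker h) : a (ker_incl h x) \in kernel h'.
Proof. by rewrite inE ab ker_inclP raddf0. Qed.

Definition ker_map_fun (x : ker h) : ker h' := Ker (ker_map_subproof x).

Lemma ker_map_additive : zmod_morphism ker_map_fun.
Proof. by move=> x y; apply: val_inj; rewrite /= !raddfB. Qed.

HB.instance Definition _ := GRing.isZmodMorphism.Build
  (ker h) (ker h') ker_map_fun ker_map_additive.

Definition ker_map : {additive ker h -> ker h'} := ker_map_fun.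

Lemma ker_mapE x : ker_incl h' (ker_map x) = a (ker_incl h x).
Proof. by []. Qed.

End KernelMap.

Section Cokernel.
Variables (V W : zmodType) (h : {additive V -> W}).

Definition range : {pred W} := [pred y | `[< exists x, h x = y >]].

Lemma rangeP y : reflect (exists x, h x = y) (y \in range).
Proof. exact: asboolP. Qed.

Lemma range_closed : zmod_closed range.
Proof.
split=> [|_ _ /rangeP[x <-] /rangeP[y <-]]; apply/rangeP.
  by exists 0; rewrite raddf0.
by exists (x - y); rewrite raddfB.
Qed.
HB.instance Definition _ := GRing.isZmodClosed.Build W range range_closed.

Definition coker : zmodType := Quotient.quot range.

Definition coker_proj : {additive W -> coker} := quot_proj range.

End Cokernel.

Section CokernelMap.
Variables (V W V' W' : zmodType).
Variables (h : {additive V -> W}) (h' : {additive V' -> W'}).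
Variables (a : {additive V -> V'}) (b : {additive W -> W'}).
Hypothesis ab : forall x, b (h x) = h' (a x).

Lemma coker_map_subproof :
  {in range h, forall y, hom_comp (coker_proj h') b y = 0}.
Proof.
move=> _ /rangeP[x <-]; apply/eqP; rewrite quot_proj_eq0 ab.
by apply/rangeP; exists (a x).
Qed.

Definition coker_map : {additive coker h -> coker h'} :=
  quot_lift coker_map_subproof.

Lemma coker_mapE y : coker_map (coker_proj h y) = coker_proj h' (b y).
Proof. exact: quot_liftE. Qed.

End CokernelMap.

Section FreeLift.
Variables (K : choiceType) (M : zmodType) (f : K -> M).

(* zmodule M is M viewed as a module over int *)
Definition free_lift_fun (D : {freeg K}) : M := @fglift int (zmodule M) K f D.

Lemma free_lift_additive : zmod_morphism free_lift_fun.
Proof. exact: (@lift_is_additive int K (zmodule M) f). Qed.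

HB.instance Definition _ :=
  GRing.isZmodMorphism.Build {freeg K} M free_lift_fun free_lift_additive.

Definition free_lift : {additive {freeg K} -> M} := free_lift_fun.

Lemma free_liftE x : free_lift << x >> = f x.
Proof. by rewrite /free_lift /= /free_lift_fun liftU scale1r. Qed.

End FreeLift.

Lemma free_hom_ext (K : choiceType) (M : zmodType) (u v : {additive {freeg K} -> M}) :
  (forall x, u << x >> = v << x >>) -> u =1 v.
Proof.
move=> uv D; rewrite -[D]freeg_sumE !raddf_sum; apply: eq_bigr => x _.
by rewrite -[coeff x D]intz -freegU_mulz !raddfMz uv.
Qed.

(* The canonical free resolution 0 -> ker (aug A) -> Z[A] -> A -> 0, where
   Z[A] is the free abelian group on the underlying set of A. *)
Definition aug (A : zmodType) : {additive {freeg A} -> A} := free_lift idfun.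

(* The first derived functor of Hom(-, C), computed by that resolution:
   Ext(A, C) = coker (Hom(Z[A], C) -> Hom(ker (aug A), C)). *)
Definition Ext (A C : zmodType) : zmodType :=
  coker (precomp C (ker_incl (aug A))).

Section ExtMap.
Variables (A A' C C' : zmodType).
Variables (f : {additive A' -> A}) (g : {additive C -> C'}).

Definition free_map : {additive {freeg A'} -> {freeg A}} :=
  free_lift (fun x => << f x >>).

Lemma free_map_aug x : aug A (free_map x) = f (aug A' x).
Proof.
apply: (free_hom_ext (u := hom_comp (aug A) free_map) (v := hom_comp f (aug A'))).
by move=> {}x; rewrite /= /free_map !free_liftE.
Qed.

Definition syzygy_map : {additive ker (aug A') -> ker (aug A)} :=
  ker_map free_map_aug.

Definition ext_cochain_map :
    {additive {additive ker (aug A) -> C} -> {additive ker (aug A') -> C'}} :=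
  hom_comp (postcomp _ g) (precomp C syzygy_map).

Lemma ext_map_subproof (u : {additive {freeg A} -> C}) :
  ext_cochain_map (precomp C (ker_incl (aug A)) u) =
  precomp C' (ker_incl (aug A')) (hom_comp (postcomp _ g) (precomp C free_map) u).
Proof. exact: additive_ext. Qed.

Definition Ext_map : {additive Ext A C -> Ext A' C'} :=
  coker_map ext_map_subproof.

End ExtMap.

Definition Ext_class (A C : zmodType) :
  {additive {additive ker (aug A) -> C} -> Ext A C} :=
  coker_proj (precomp C (ker_incl (aug A))).

Lemma Ext_mapE (A A' C C' : zmodType) (f : {additive A' -> A})
    (g : {additive C -> C'}) (u : {additive ker (aug A) -> C}) :
  Ext_map f g (Ext_class A C u) =
  Ext_class A' C' (hom_comp g (hom_comp u (syzygy_map f))).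
Proof. exact: coker_mapE. Qed.

Lemma Ext_map_id (A C : zmodType) (x : Ext A C) :
  Ext_map (hom_id A) (hom_id C) x = x.
Proof.
have [u ->] := quot_proj_surj x; rewrite Ext_mapE; congr (Ext_class A C _).
apply: additive_ext => k /=; congr (u _); apply: val_inj => /=.
by apply: (free_hom_ext (v := hom_id _)) => a; rewrite free_liftE.
Qed.

Lemma Ext_map_comp (A A' A'' C C' C'' : zmodType)
    (f : {additive A' -> A}) (f' : {additive A'' -> A'})
    (g : {additive C -> C'}) (g' : {additive C' -> C''}) (x : Ext A C) :
  Ext_map (hom_comp f f') (hom_comp g' g) x = Ext_map f' g' (Ext_map f g x).
Proof.
have [u ->] := quot_proj_surj x; rewrite Ext_mapE (Ext_mapE f g u) Ext_mapE.
congr (Ext_class A'' C'' _).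
apply: additive_ext => k /=; congr (g' (g (u _))); apply: val_inj => /=.
apply: (free_hom_ext (v := hom_comp (free_map f) (free_map f'))) => a.
by rewrite /= /free_map !free_liftE.
Qed.

Definition whitehead (A : zmodType) : Prop := forall x : Ext A int, x = 0.

Record wgroup := WGroup { wgroup_sort :> zmodType; wgroupP : whitehead wgroup_sort }.

Section GeneratedSubgroup.
Variables (V : zmodType) (S : V -> Prop).

Definition gen_subgroup : {pred V} :=
  [pred x | `[< forall I : {pred V}, zmod_closed I ->
                  (forall s, S s -> s \in I) -> x \in I >]].

Lemma gen_subgroupP x :
  reflect (forall I : {pred V}, zmod_closed I ->
             (forall s, S s -> s \in I) -> x \in I) (x \in gen_subgroup).
Proof. exact: asboolP. Qed.

Lemma gen_subgroup_closed : zmod_closed gen_subgroup.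
Proof.
split=> [|x y /gen_subgroupP xS /gen_subgroupP yS]; apply/gen_subgroupP => I Ic SI.
  by case: Ic.
by case: (Ic) => _ IB; apply: IB; [exact: xS | exact: yS].
Qed.
HB.instance Definition _ := GRing.isZmodClosed.Build V gen_subgroup gen_subgroup_closed.

Lemma mem_gen_subgroup s : S s -> s \in gen_subgroup.
Proof. by move=> Ss; apply/gen_subgroupP => I _; apply. Qed.

End GeneratedSubgroup.

Section Tensor.
Variables A B : zmodType.

Inductive tensor_rel : {freeg (A * B)} -> Prop :=
| TensorRelL (a a' : A) (b : B) :
    tensor_rel (<< (a + a', b) >> - << (a, b) >> - << (a', b) >>)
| TensorRelR (a : A) (b b' : B) :
    tensor_rel (<< (a, b + b') >> - << (a, b) >> - << (a, b') >>).

Definition tensor : zmodType := Quotient.quot (gen_subgroup tensor_rel).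

Definition tens (a : A) (b : B) : tensor := quot_proj (gen_subgroup tensor_rel) << (a, b) >>.

Lemma tensDl a a' b : tens (a + a') b = tens a b + tens a' b.
Proof.
apply/eqP; rewrite -subr_eq0 opprD addrA -!raddfB quot_proj_eq0.
exact: (mem_gen_subgroup (TensorRelL _ _ _)).
Qed.

Lemma tensDr a b b' : tens a (b + b') = tens a b + tens a b'.
Proof.
apply/eqP; rewrite -subr_eq0 opprD addrA -!raddfB quot_proj_eq0.
exact: (mem_gen_subgroup (TensorRelR _ _ _)).
Qed.

Lemma tensor_hom_ext (M : zmodType) (u v : {additive tensor -> M}) :
  (forall a b, u (tens a b) = v (tens a b)) -> u =1 v.
Proof.
move=> uv y; have [x ->] := quot_proj_surj y.
pose p := quot_proj (gen_subgroup tensor_rel).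
by apply: (free_hom_ext (u := hom_comp u p) (v := hom_comp v p)) => -[a b]; exact: uv.
Qed.

Section Lift.
Variables (M : zmodType) (m : A -> B -> M).
Hypothesis mDl : forall a a' b, m (a + a') b = m a b + m a' b.
Hypothesis mDr : forall a b b', m a (b + b') = m a b + m a b'.

Definition tensor_prelift : {additive {freeg (A * B)} -> M} :=
  free_lift (fun ab => m ab.1 ab.2).

Lemma tensor_lift_subproof :
  {in gen_subgroup tensor_rel, forall x, tensor_prelift x = 0}.
Proof.
move=> x /gen_subgroupP /(_ (kernel tensor_prelift) (kernel_closed _)) xP.
apply/eqP/xP => _ [a a' b|a b b']; rewrite inE !raddfB /= !free_liftE /=.
  by rewrite mDl addrAC addrK subrr.
by rewrite mDr addrAC addrK subrr.
Qed.

Definition tensor_lift : {additive tensor -> M} := quot_lift tensor_lift_subproof.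

Lemma tensor_liftE a b : tensor_lift (tens a b) = m a b.
Proof. by rewrite /tensor_lift quot_liftE free_liftE. Qed.

End Lift.
End Tensor.

Section TensorMap.
Variables (A A' B B' : zmodType).
Variables (f : {additive A' -> A}) (g : {additive B' -> B}).

Lemma tensor_mapDl a a' b : tens (f (a + a')) (g b) = tens (f a) (g b) + tens (f a') (g b).
Proof. by rewrite raddfD tensDl. Qed.

Lemma tensor_mapDr a b b' : tens (f a) (g (b + b')) = tens (f a) (g b) + tens (f a) (g b').
Proof. by rewrite raddfD tensDr. Qed.

Definition tensor_map : {additive tensor A' B' -> tensor A B} :=
  tensor_lift (m := fun a b => tens (f a) (g b)) tensor_mapDl tensor_mapDr.

Lemma tensor_mapE a b : tensor_map (tens a b) = tens (f a) (g b).
Proof. exact: tensor_liftE. Qed.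

End TensorMap.

Lemma tensor_map_id (A B : zmodType) : tensor_map (hom_id A) (hom_id B) =1 id.
Proof. by apply: (tensor_hom_ext (v := hom_id _)) => a b; rewrite tensor_mapE. Qed.

Lemma tensor_map_comp (A A' A'' B B' B'' : zmodType)
    (f : {additive A' -> A}) (f' : {additive A'' -> A'})
    (g : {additive B' -> B}) (g' : {additive B'' -> B'}) :
  tensor_map (hom_comp f f') (hom_comp g g') =1 tensor_map f g \o tensor_map f' g'.
Proof.
apply: (tensor_hom_ext (v := hom_comp (tensor_map f g) (tensor_map f' g'))) => a b.
rewrite tensor_mapE -[RHS]/(tensor_map f g (tensor_map f' g' (tens a b))).
by rewrite !tensor_mapE.
Qed.

(* Main.v *)
(* Write F_A = Z[A] and K_A = ker (F_A -> A), so that Ext(A, B^* ) consists of the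
   bilinear maps u : K_A x B -> Z modulo those that extend to F_A x B.

   First isomorphism: since F_B is free and Ext(A, Z) = 0, the pullback of u to
   K_A x F_B extends to v : F_A x F_B -> Z; as v vanishes on K_A x K_B, its
   restriction to F_A x K_B descends to w : A x K_B -> Z, a class in Ext(B, A^* ).
   The relation between u and w is symmetric in A and B.

   Second isomorphism: let p : F_A (x) B -> A (x) B. The map K_A (x) B -> ker p is
   onto with torsion kernel, so u amounts to a homomorphism h : ker p -> Z. The
   connecting map Hom(ker p, Z) -> Ext(A (x) B, Z) is onto, because
   Ext(F_A (x) B, Z) is a product of copies of Ext(B, Z) = 0, and it kills exactly
   the h that extend to F_A (x) B, that is, the u that extend to F_A x B. *)
Require Import Defs.
From HB Require Import structures.
From mathcomp Require Import all_boot all_algebra.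
From mathcomp Require Import boolp.
From mathcomp.multinomials Require Import freeg.

Set Implicit Arguments.
Unset Strict Implicit.
Unset Printing Implicit Defensive.

Import GRing.Theory.
Local Open Scope ring_scope.

(** * Additive maps from relations, factorization and currying *)

Lemma subrACA (V : zmodType) (x y z t : V) : x - y - (z - t) = x - z - (y - t).
Proof. by rewrite opprD addrACA -opprD. Qed.

Lemma hom_compE (A B C : zmodType) (g : {additive B -> C}) (f : {additive A -> B}) x :
  hom_comp g f x = g (f x).
Proof. by []. Qed.

Lemma additiveP (V W : zmodType) (f : V -> W) :
  zmod_morphism f -> exists g : {additive V -> W}, g =1 f.
Proof.
move=> fB; pose m := GRing.isZmodMorphism.Build V W f fB.
by exists (HB.pack_for {additive V -> W} f m).
Qed.

Section AdditiveRelation.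
Variables (V W : zmodType) (R : V -> W -> Prop).
Hypothesis RB : forall x y x' y', R x y -> R x' y' -> R (x - x') (y - y').
Hypothesis R_total : forall x, exists y, R x y.
Hypothesis R0 : forall y, R 0 y -> y = 0.

(** Two values at one point differ by a value at 0, so [RB] and [R0] give uniqueness. Maps built
    from choices of extensions or lifts thus need their independence checked at 0 only. *)
Lemma additive_relationP :
  exists f : {additive V -> W}, forall x y, R x y <-> f x = y.
Proof.
have Rfun x y y' : R x y -> R x y' -> y = y'.
  by move=> xy xy'; apply/subr0_eq/R0; rewrite -(subrr x); apply: RB.
have [f fR] := choice R_total.
have [x y|g gf] := @additiveP V W f; first by apply: Rfun (fR _) _; apply: RB.
exists g => x y; rewrite gf; split=> [xy|<- //]; exact: Rfun (fR x) xy.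
Qed.

Lemma additive_relation_bij :
  (forall y, exists x, R x y) -> (forall x, R x 0 -> x = 0) ->
  exists2 f : {additive V -> W}, bijective f & forall x y, R x y <-> f x = y.
Proof.
move=> R_surj R_inj; have [f fR] := additive_relationP.
exists f => //; have [g gR] := choice R_surj.
have gK : cancel g f by move=> y; apply/fR.
exists g => // x; apply/subr0_eq/R_inj/fR.
by rewrite raddfB gK subrr.
Qed.

End AdditiveRelation.

Lemma additive_factor (V W C : zmodType) (q : {additive V -> W}) (h : {additive V -> C}) :
  (forall w, exists v, q v = w) -> (forall v, q v = 0 -> h v = 0) ->
  exists g : {additive W -> C}, forall v, g (q v) = h v.
Proof.
move=> q_surj hq.
have [|w|_ [v qv <-]|g gP] :=
    @additive_relationP W C (fun w c => exists2 v, q v = w & h v = c).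
- by move=> _ _ _ _ [v <- <-] [v' <- <-]; exists (v - v'); rewrite raddfB.
- by have [v <-] := q_surj w; exists (h v), v.
- exact: hq.
by exists g => v; apply/gP; exists v.
Qed.

Lemma additive_flip (A B C : zmodType) (v : {additive A -> {additive B -> C}}) :
  exists w : {additive B -> {additive A -> C}}, forall a b, w b a = v a b.
Proof.
have colP b : exists c : {additive A -> C}, c =1 v^~ b.
  by apply: additiveP => x y; rewrite raddfB.
have [c cP] := choice colP.
have [x y|w wc] := @additiveP B _ c.
  by apply: additive_ext => a; rewrite hom_subE !cP raddfB.
by exists w => a b; rewrite wc cP.
Qed.

(** * The canonical resolution and the vanishing of Ext classes *)

Lemma aug_surj (A : zmodType) (a : A) : exists f, aug A f = a.
Proof. by exists << a >>; rewrite /aug free_liftE. Qed.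

Lemma ker_inclK (V W : zmodType) (h : {additive V -> W}) v :
  h v = 0 -> exists k : ker h, ker_incl h k = v.
Proof.
move=> hv; have vk : v \in kernel h by rewrite inE hv.
by exists (Ker vk).
Qed.

Lemma Ext_class_surj (A C : zmodType) (x : Ext A C) :
  exists u, x = Ext_class A C u.
Proof. exact: quot_proj_surj. Qed.

Lemma Ext_class_eq0 (A C : zmodType) (u : {additive ker (aug A) -> C}) :
  Ext_class A C u = 0 <->
  exists t : {additive {freeg A} -> C}, forall k, t (ker_incl (aug A) k) = u k.
Proof.
split=> [/eqP|[t tu]].
  by rewrite quot_proj_eq0 => /rangeP[t <-]; exists t.
apply/eqP; rewrite quot_proj_eq0; apply/rangeP; exists t.
exact: additive_ext.
Qed.

(** Each [u << x >>] represents a class in Ext(A, C) = 0 and so extends to Z[A]; freeness lets these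
    extensions be chosen independently for each basis element. *)
Lemma free_bilinear_extend (K : choiceType) (A C : zmodType)
    (u : {additive {freeg K} -> {additive ker (aug A) -> C}}) :
  (forall x : Ext A C, x = 0) ->
  exists v : {additive {freeg K} -> {additive {freeg A} -> C}},
    forall d k, v d (ker_incl (aug A) k) = u d k.
Proof.
move=> A0; have tP x := (Ext_class_eq0 (u << x >>)).1 (A0 _).
have [t tu] := choice tP; exists (free_lift t) => d k.
pose r : {additive _ -> {additive ker (aug A) -> C}} :=
  hom_comp (precomp C (ker_incl (aug A))) (free_lift t).
suff : r =1 u by move=> /(_ d) <-.
by apply: free_hom_ext => x; apply: additive_ext => l; rewrite /= free_liftE -tu.
Qed.

(** * First isomorphism: exchanging A and B *)

Section Swap.
Variables A B : zmodType.

(** With [v] kept as a witness the relation is symmetric, so surjectivity and injectivity are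
    totality and single-valuedness with A and B exchanged. *)
Definition swap_rel (x : Ext A (dual B)) (y : Ext B (dual A)) : Prop :=
  exists u w (v : {additive {freeg A} -> dual {freeg B}}),
    [/\ x = Ext_class A (dual B) u, y = Ext_class B (dual A) w,
        forall k f, v (ker_incl (aug A) k) f = u k (aug B f)
      & forall f k, v f (ker_incl (aug B) k) = w k (aug A f)].

Lemma swap_relB x y x' y' :
  swap_rel x y -> swap_rel x' y' -> swap_rel (x - x') (y - y').
Proof.
move=> [u [w [v [-> -> vu vw]]]] [u' [w' [v' [-> -> vu' vw']]]].
exists (u - u'), (w - w'), (v - v'); split; rewrite ?raddfB // => f k.
  by rewrite !hom_subE vu vu'.
by rewrite !hom_subE vw vw'.
Qed.

Lemma swap_rel_total x : whitehead A -> exists y, swap_rel x y.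
Proof.
move=> A0; have [u ->] := Ext_class_surj x.
(* The free variable F_B is put first, so that each of its basis elements gives a map K_A -> Z to
   extend. *)
have [u' u'E] := additive_flip (hom_comp (precomp int (aug B)) u).
have [v' v'E] := free_bilinear_extend u' A0.
have [v vE] := additive_flip v'.
have vu k f : v (ker_incl (aug A) k) f = u k (aug B f).
  by rewrite vE v'E u'E.
have [||w wE] := @additive_factor _ _ _ (aug A) (hom_comp (precomp int (ker_incl (aug B))) v).
- exact: aug_surj.
- move=> f /ker_inclK[k <-]; apply: additive_ext => l /=.
  by rewrite vu ker_inclP raddf0.
have [w' w'E] := additive_flip w.
exists (Ext_class B (dual A) w'), u, w', v; split=> // f k.
by rewrite w'E wE.
Qed.

(** Let t extend u to F_A. Subtracting the pullback of t from v keeps its values on F_A x K_B and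
    makes it vanish on K_A x F_B; the difference descends to A x F_B and extends w. *)
Lemma swap_rel0 y : swap_rel 0 y -> y = 0.
Proof.
move=> [u [w [v [/esym/Ext_class_eq0[t tu] -> vu vw]]]]; apply/Ext_class_eq0.
pose v' := v - hom_comp (precomp int (aug B)) t.
have [||s sE] := @additive_factor _ _ _ (aug A) v'.
- exact: aug_surj.
- move=> f /ker_inclK[k <-]; apply: additive_ext => l.
  by rewrite /v' !hom_subE /= vu tu subrr.
have [s' s'E] := additive_flip s.
exists s' => k; apply: additive_ext => a; have [f <-] := aug_surj a.
by rewrite s'E sE /v' !hom_subE /= ker_inclP raddf0 subr0 vw.
Qed.

End Swap.

Lemma swap_rel_sym (A B : zmodType) x y : @swap_rel A B x y -> @swap_rel B A y x.
Proof.
move=> [u [w [v [xu yw vu vw]]]]; have [v' v'E] := additive_flip v.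
by exists w, u, v'; split=> // f k; rewrite v'E.
Qed.

Lemma swap_rel_natural (A A' B B' : zmodType) (f : {additive A' -> A})
    (g : {additive B' -> B}) x y :
  swap_rel x y ->
  swap_rel (Ext_map f (dual_map g) x) (Ext_map g (dual_map f) y).
Proof.
move=> [u [w [v [-> -> vu vw]]]].
exists (hom_comp (dual_map g) (hom_comp u (syzygy_map f))).
exists (hom_comp (dual_map f) (hom_comp w (syzygy_map g))).
exists (hom_comp (precomp int (free_map g)) (hom_comp v (free_map f))).
split=> [||k d|d k]; rewrite ?Ext_mapE //=.
  by rewrite -free_map_aug -vu.
by rewrite -free_map_aug -vw.
Qed.

(** * Kernels and the connecting homomorphism *)

Lemma ker_incl_inj (V W : zmodType) (h : {additive V -> W}) : injective (ker_incl h).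
Proof. exact: val_inj. Qed.

Lemma additive_corestrict (U V W : zmodType) (h : {additive V -> W}) (f : {additive U -> V}) :
  (forall x, h (f x) = 0) ->
  exists g : {additive U -> ker h}, forall x, ker_incl h (g x) = f x.
Proof.
move=> hf; have [g gE] := choice (fun x => ker_inclK (hf x)).
have [x y|g' g'E] := @additiveP _ _ g.
  by apply: ker_incl_inj; rewrite raddfB !gE raddfB.
by exists g' => x; rewrite g'E gE.
Qed.

Section Connecting.
Variables (E T C : zmodType) (p : {additive E -> T}).
Implicit Types (h : {additive ker p -> C}) (w : {additive ker (aug T) -> C}).

(* w represents the image of h under Hom(ker p, C) -> Ext(T, C). Stating this as a
   relation witnessed by t avoids choosing a lift of aug T along p. *)
Definition connecting h w : Prop :=
  exists t : {additive {freeg E} -> C},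
    forall d k l, ker_incl (aug T) k = free_map p d -> ker_incl p l = aug E d ->
      t d = w k - h l.

Lemma connectingB h w h' w' :
  connecting h w -> connecting h' w' -> connecting (h - h') (w - w').
Proof.
move=> [t tE] [t' t'E]; exists (t - t') => d k l dk dl.
by rewrite !hom_subE (tE d k l) // (t'E d k l) // subrACA.
Qed.

Lemma connecting_lift (d : {freeg E}) l :
  ker_incl p l = aug E d -> exists k, ker_incl (aug T) k = free_map p d.
Proof. by move=> dl; apply: ker_inclK; rewrite free_map_aug -dl ker_inclP. Qed.

(** A set-theoretic section of p gives a lift [sg] of [aug T] to E, and w is h composed with its
    restriction K_T -> ker p. The witness is h applied to the difference of [sg] after [free_map p]
    and [aug E], which lies in ker p. *)
Lemma connecting_total h :
  (forall y, exists x, p x = y) -> exists w, connecting h w.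
Proof.
move=> p_surj; have [s sK] := choice p_surj; pose sg := free_lift s.
have sgK d : p (sg d) = aug T d.
  apply: (free_hom_ext (u := hom_comp p sg)) => y.
  by rewrite /= /sg /aug !free_liftE.
have [|f fE] := @additive_corestrict _ _ _ p (hom_comp sg (ker_incl (aug T))).
  by move=> k; rewrite /= sgK ker_inclP.
have [|g gE] := @additive_corestrict _ _ _ p (hom_comp sg (free_map p) - aug E).
  by move=> d; rewrite hom_subE raddfB /= sgK free_map_aug subrr.
exists (hom_comp h f), (hom_comp h g) => d k l kd ld; rewrite /= -raddfB; congr (h _).
by apply: ker_incl_inj; rewrite raddfB gE fE hom_subE !hom_compE kd ld.
Qed.

(** As Ext(E, C) = 0, the pullback of w to K_E extends to t on Z[E]. Then h l is w k - t d for any d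
    above l; the choice of d is immaterial because t agrees with the pullback of w on K_E. *)
Lemma connecting_surj w : (forall x : Ext E C, x = 0) -> exists h, connecting h w.
Proof.
move=> E0.
have /Ext_class_eq0[t tE] := E0 (Ext_class E C (hom_comp w (syzygy_map p))).
pose R l c := exists d k,
  [/\ aug E d = ker_incl p l, ker_incl (aug T) k = free_map p d & c = w k - t d].
have [|l|c|h hE] := @additive_relationP (ker p) C R.
- move=> l _ l' _ [d [k [dl kd ->]]] [d' [k' [dl' kd' ->]]].
  exists (d - d'), (k - k'); split.
  + by rewrite !raddfB dl dl'.
  + by rewrite !raddfB kd kd'.
  + by rewrite (raddfB w) (raddfB t) subrACA.
- have [d dl] := aug_surj (ker_incl p l).
  by have [k kd] := connecting_lift (esym dl); exists (w k - t d), d, k.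
- move=> [d [k [dl kd ->]]].
  have [j jd] := ker_inclK dl; rewrite -jd tE /=; apply/eqP.
  by rewrite subr_eq0; apply/eqP; congr (w _); apply: ker_incl_inj; rewrite kd -jd.
exists h, t => d k l kd ld; have /hE -> : R l (w k - t d) by exists d, k.
by rewrite subKr.
Qed.

(** If s extends w to Z[T], then s after [free_map p], minus t, vanishes on K_E (the case l = 0) and
    descends to E. On ker p it takes the value w k - (w k - h l) = h l. *)
Lemma connecting0_extends h w : connecting h w -> Ext_class T C w = 0 ->
  exists g : {additive E -> C}, forall l, g (ker_incl p l) = h l.
Proof.
move=> [t tE] /Ext_class_eq0[s sE].
pose r := hom_comp s (free_map p) - t.
have [||g gE] := @additive_factor _ _ _ (aug E) r; first exact: aug_surj.
  move=> d d0; have [k kd] := connecting_lift (esym (etrans d0 (esym (raddf0 (ker_incl p))))).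
  by rewrite /r hom_subE hom_compE -kd sE (tE d k 0) // raddf0 subr0 subrr.
exists g => l; have [d dl] := aug_surj (ker_incl p l).
have [k kd] := connecting_lift (esym dl).
by rewrite -dl gE /r hom_subE hom_compE -kd sE (tE d k l) // subKr.
Qed.

(** Where [free_map p] lands in K_T, the map t + g (aug E) equals the pullback of w; composing it
    with a section of [free_map p] extends w to Z[T]. *)
Lemma extends_connecting0 h w (g : {additive E -> C}) :
  (forall y, exists x, p x = y) ->
  connecting h w -> (forall l, g (ker_incl p l) = h l) -> Ext_class T C w = 0.
Proof.
move=> p_surj [t tE] gh; have [s sK] := choice p_surj.
pose sg : {additive {freeg T} -> {freeg E}} := free_lift (fun y => << s y >>).
have sgK d : free_map p (sg d) = d.
  apply: (free_hom_ext (u := hom_comp (free_map p) sg) (v := hom_id _)) => y.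
  by rewrite /= /sg /free_map !free_liftE sK.
apply/Ext_class_eq0; exists (hom_comp (t + hom_comp g (aug E)) sg) => k.
have [l lk] : exists l, ker_incl p l = aug E (sg (ker_incl (aug T) k)).
  by apply: ker_inclK; rewrite -free_map_aug sgK ker_inclP.
by rewrite hom_compE hom_addE hom_compE -lk gh (tE _ k l) ?sgK // subrK.
Qed.

End Connecting.

Lemma free_map_comp (A B C : zmodType) (f : {additive A -> B}) (g : {additive B -> C}) d :
  free_map (hom_comp g f) d = free_map g (free_map f d).
Proof.
apply: (free_hom_ext (v := hom_comp (free_map g) (free_map f))) => x.
by rewrite /= /free_map !free_liftE.
Qed.

Lemma connecting_natural (E T E' T' C : zmodType)
    (p : {additive E -> T}) (p' : {additive E' -> T'})
    (a : {additive E' -> E}) (c : {additive T' -> T})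
    (pa : forall x, p (a x) = c (p' x))
    (h : {additive ker p -> C}) (w : {additive ker (aug T) -> C}) :
  connecting h w ->
  connecting (hom_comp h (ker_map pa)) (hom_comp w (syzygy_map c)).
Proof.
move=> [t tE]; exists (hom_comp t (free_map a)) => d k l kd ld.
apply: tE; rewrite ker_mapE; last by rewrite ld free_map_aug.
rewrite kd -!free_map_comp; congr (free_map _ d).
by apply: additive_ext => x; rewrite /= pa.
Qed.

(** The canonical resolution of a free group splits, and u composed with the retraction onto the
    kernel extends u. *)
Lemma Ext_free (K : choiceType) (C : zmodType) (x : Ext {freeg K} C) : x = 0.
Proof.
have [u ->] := Ext_class_surj x; apply/Ext_class_eq0.
pose s : {additive {freeg K} -> {freeg {freeg K}}} := free_lift (fun k => << << k >> >>).
have sK d : aug _ (s d) = d.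
  apply: (free_hom_ext (u := hom_comp (aug _) s) (v := hom_id _)) => k.
  by rewrite /= /s /aug !free_liftE.
have [|r rE] := @additive_corestrict _ _ _ (aug {freeg K}) (hom_id _ - hom_comp s (aug _)).
  by move=> d; rewrite hom_subE raddfB /= sK subrr.
exists (hom_comp u r) => k; congr (u _); apply: ker_incl_inj.
by rewrite rE hom_subE !hom_compE ker_inclP raddf0 subr0.
Qed.

(** * Tensor products: right exactness, and Ext of a free group tensored with B *)

Lemma coker_proj_eq0 (V W : zmodType) (h : {additive V -> W}) y :
  coker_proj h y = 0 <-> exists x, h x = y.
Proof.
split=> [/eqP|hy]; first by rewrite quot_proj_eq0 => /rangeP.
by apply/eqP; rewrite quot_proj_eq0; apply/rangeP.
Qed.

Lemma tensorP (A B : zmodType) :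
  exists t : {additive A -> {additive B -> tensor A B}}, forall a b, t a b = tens a b.
Proof.
have rP a : exists r : {additive B -> tensor A B}, r =1 tens a.
  by apply: additiveP => b b'; rewrite -[b in RHS](subrK b') [in RHS]tensDr addrK.
have [r rE] := choice rP; have [a a'|t tE] := @additiveP _ _ r.
  apply: additive_ext => b.
  by rewrite hom_subE !rE -[a in RHS](subrK a') [in RHS]tensDl addrK.
by exists t => a b; rewrite tE rE.
Qed.

Lemma tensor_bilinear_lift (A B M : zmodType) (m : {additive A -> {additive B -> M}}) :
  exists l : {additive tensor A B -> M}, forall a b, l (tens a b) = m a b.
Proof.
have mDl a a' b : m (a + a') b = m a b + m a' b by rewrite raddfD.
have mDr a b b' : m a (b + b') = m a b + m a b' by rewrite raddfD.
by exists (tensor_lift mDl mDr) => a b; rewrite tensor_liftE.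
Qed.

Lemma hom_mulzE (A B : zmodType) (f : {additive A -> B}) (n : int) x :
  (f *~ n) x = f x *~ n.
Proof.
have hom_mulnE m : (f *+ m) x = f x *+ m by elim: m => // m IH; rewrite !mulrS hom_addE IH.
by case: n => n; [exact: hom_mulnE | rewrite -[RHS]/(- (f x *+ n.+1)) -hom_mulnE].
Qed.

Lemma hom_sumE (A B : zmodType) (I : Type) (r : seq I) (f : I -> {additive A -> B}) x :
  (\sum_(i <- r) f i) x = \sum_(i <- r) f i x.
Proof. by elim/big_rec2: _ => // i _ g _ <-; rewrite hom_addE. Qed.

Lemma tensor_sum (A B : zmodType) (z : tensor A B) :
  exists s : seq (A * B), z = \sum_(x <- s) tens x.1 x.2.
Proof.
have [t tE] := tensorP A B; have [d ->] := quot_proj_surj z.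
(* The integer coefficients are absorbed into the left factor. *)
exists [seq (x.1 *~ coeff x d, x.2) | x <- dom d]; rewrite big_map.
rewrite -[in LHS](freeg_sumE d) raddf_sum; apply: eq_bigr => -[a b] _ /=.
rewrite -[coeff _ d]intz -freegU_mulz raddfMz intz -tE raddfMz.
by rewrite hom_mulzE tE.
Qed.

Section RightExact.
Variables (A' A B : zmodType) (f : {additive A' -> A}).

Lemma tensor_map_surj :
  (forall a, exists a', f a' = a) ->
  forall y, exists x, tensor_map f (hom_id B) x = y.
Proof.
move=> f_surj y; apply/coker_proj_eq0.
apply: (tensor_hom_ext (u := coker_proj _) (v := hom_zero _ _)) => a b.
have [a' <-] := f_surj a; apply/coker_proj_eq0; exists (tens a' b).
exact: tensor_mapE.
Qed.

(** The projection [pr] of A' (x) B onto the cokernel of ker f (x) B factors through f (x) B, since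
    it kills the tensors k (x) b with k in ker f; hence it kills e. *)
Lemma tensor_right_exact :
  (forall a, exists a', f a' = a) ->
  forall e, tensor_map f (hom_id B) e = 0 ->
  exists z, tensor_map (ker_incl f) (hom_id B) z = e.
Proof.
move=> f_surj e e0; apply/coker_proj_eq0.
set i := tensor_map _ _; pose pr := coker_proj i.
have [t tE] := tensorP A' B.
have [||m mE] := @additive_factor _ _ _ f (hom_comp (postcomp B pr) t) => //.
  move=> a' /ker_inclK[k <-]; apply: additive_ext => b /=.
  apply/coker_proj_eq0; exists (tens k b).
  by rewrite /i tensor_mapE tE.
have [l lE] := tensor_bilinear_lift m.
suff <- : l (tensor_map f (hom_id B) e) = pr e by rewrite e0 raddf0.
apply: (tensor_hom_ext (u := hom_comp l (tensor_map f (hom_id B)))) => a b.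
by rewrite hom_compE tensor_mapE lE mE /= tE.
Qed.

End RightExact.

(** Present the tensor product by [q] on Z[K x B], which contains a copy [j k] of Z[B] for each k.
    The class of w comes from some h on ker q; h extends along each copy by Ext(B, C) = 0, and the
    extensions assemble to g on Z[K x B]. *)
Lemma Ext_free_tensor (K : choiceType) (B C : zmodType) :
  (forall x : Ext B C, x = 0) -> forall x : Ext (tensor {freeg K} B) C, x = 0.
Proof.
move=> B0 x; have [w ->] := Ext_class_surj x.
have [tn tnE] := tensorP {freeg K} B.
pose q : {additive {freeg (K * B)} -> tensor {freeg K} B} :=
  free_lift (fun kb => tens << kb.1 >> kb.2).
pose j k : {additive {freeg B} -> {freeg (K * B)}} := free_lift (fun b => << (k, b) >>).
have qj k d : q (j k d) = tens << k >> (aug B d).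
  rewrite -tnE; apply: (free_hom_ext (u := hom_comp q (j k))
                               (v := hom_comp (tn << k >>) (aug B))) => b.
  by rewrite !hom_compE /j /q /aug !free_liftE tnE.
have q_surj y : exists d, q d = y.
  apply/coker_proj_eq0.
  apply: (tensor_hom_ext (u := coker_proj _) (v := hom_zero _ _)) => d b.
  have [tf tfE] := additive_flip tn; rewrite -tnE -tfE.
  apply: (free_hom_ext (u := hom_comp (coker_proj q) (tf b)) (v := hom_zero _ _)) => k.
  rewrite hom_compE; apply/coker_proj_eq0; exists << (k, b) >>.
  by rewrite tfE tnE /q free_liftE.
have [h hw] := connecting_surj q w (@Ext_free _ C).
have jP k : exists jk : {additive ker (aug B) -> ker q},
    forall d, ker_incl q (jk d) = j k (ker_incl (aug B) d).
  apply: (additive_corestrict (f := hom_comp (j k) (ker_incl (aug B)))) => d.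
  by rewrite hom_compE qj ker_inclP -tnE raddf0.
have [jk jkE] := choice jP.
have tP k := (Ext_class_eq0 (hom_comp h (jk k))).1 (B0 _).
have [t tE] := choice tP.
pose g : {additive {freeg (K * B)} -> C} := free_lift (fun kb => t kb.1 << kb.2 >>).
have gj k d : g (j k d) = t k d.
  apply: (free_hom_ext (u := hom_comp g (j k))) => b.
  by rewrite hom_compE /j /g !free_liftE.
apply: (extends_connecting0 (g := g) q_surj hw).
(* To see that g = h on all of ker q, divide Z[K x B] by the subgroup of ker q where they agree. It
   contains the copies of K_B, so the projection [pr] factors through [q] and kills ker q. *)
pose i := hom_comp (ker_incl q) (ker_incl (hom_comp g (ker_incl q) - h)).
pose pr := coker_proj i.
have mP k : exists m : {additive B -> coker i}, forall d, m (aug B d) = pr (j k d).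
  apply: (additive_factor (h := hom_comp pr (j k))) => [|d]; first exact: aug_surj.
  move=> /ker_inclK[e <-]; rewrite hom_compE; apply/coker_proj_eq0.
  have [|e' e'E] := @ker_inclK _ _ (hom_comp g (ker_incl q) - h) (jk k e).
    by rewrite hom_subE hom_compE jkE gj tE subrr.
  by exists e'; rewrite /i hom_compE e'E jkE.
have [m mE] := choice mP.
have [l lE] := tensor_bilinear_lift (free_lift m).
have lq : hom_comp l q =1 pr.
  apply: free_hom_ext => -[k b].
  have [d db] := aug_surj b.
  rewrite hom_compE /q free_liftE lE free_liftE /=.
  have -> : b = aug B << b >> by rewrite /aug free_liftE.
  by rewrite mE /j /aug !free_liftE.
move=> y; have /coker_proj_eq0[z zE] : pr (ker_incl q y) = 0.
  by rewrite -lq hom_compE ker_inclP raddf0.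
have <- : ker_incl _ z = y by apply: ker_incl_inj.
apply/subr0_eq; exact: ker_inclP z.
Qed.

(** * Integer matrices and the torsion kernel of K (x) B -> Z[X] (x) B *)

Lemma rat_matrix_denominator (m n : nat) (X : 'M[rat]_(m, n)) :
  exists2 d : int, d != 0 & exists N : 'M[int]_(m, n), map_mx intr N = d%:~R *: X.
Proof.
pose D (P : pred ('I_m * 'I_n)) : int := \prod_(p | P p) denq (X p.1 p.2).
exists (D predT); first by apply/prodf_neq0 => p _; apply: denq_neq0.
exists (\matrix_(i, j) (numq (X i j) * D (predC1 (i, j)))).
apply/matrixP => i j; rewrite !mxE [D predT](bigD1 (i, j)) //=.
rewrite !rmorphM /= mulrC [RHS]mulrAC mulrC; congr (_ * _).
by rewrite [RHS]mulrC numqE.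
Qed.

(** N is a rational pseudo-inverse of M with its denominators cleared by d. *)
Lemma int_matrix_pseudo_inverse (m n : nat) (M : 'M[int]_(m, n)) :
  exists2 d : int, d != 0 & exists N : 'M[int]_(n, m), M *m N *m M = d *: M.
Proof.
pose MQ : 'M[rat]_(m, n) := map_mx intr M.
have [d d0 [N NE]] := rat_matrix_denominator (pinvmx MQ).
exists d => //; exists N.
have MNMQ : map_mx intr (M *m N *m M) = map_mx intr (d *: M) :> 'M[rat]_(m, n).
  by rewrite !map_mxM NE map_mxZ -scalemxAr -scalemxAl mulmxKpV.
apply/matrixP => r c; move/matrixP/(_ r c): MNMQ.
by rewrite [LHS]mxE [RHS]mxE => /intr_inj.
Qed.

(* The kernel of i (x) B is torsion: let z = sum_j k_j (x) b_j, let M be the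
   coefficient matrix of the i k_j, and let M N M = d M. Then d k_j is the sum of
   (M N)_jl k_l, so that d z = sum_l k_l (x) b'_l where b'_l, the sum of
   (M N)_jl b_j, vanishes because (i (x) B) z = 0 says that sum_j M_jc b_j = 0. *)
Lemma bilinear_vanishes_on_tor (X : choiceType) (K B : zmodType)
    (i : {additive K -> {freeg X}}) (u : {additive K -> {additive B -> int}})
    (l : {additive tensor K B -> int}) (z : tensor K B) :
  injective i -> (forall k b, l (tens k b) = u k b) ->
  tensor_map i (hom_id B) z = 0 -> l z = 0.
Proof.
move=> i_inj lE; have [s ->] := tensor_sum z; set n := size s.
rewrite big_tnth; set k := fun j : 'I_n => (tnth (in_tuple s) j).1.
set b := fun j : 'I_n => (tnth (in_tuple s) j).2 => z0.
(* The coordinate at a gives a bilinear map Z[X] x B -> B, which is applied to (i (x) B) z = 0. *)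
have b0 a : \sum_j b j *~ coeff a (i (k j)) = 0.
  have [c cE] : exists c : {additive {freeg X} -> {additive B -> B}},
      forall f b, c f b = b *~ coeff a f.
    have cP f : exists c : {additive B -> B}, c =1 *~%R^~ (coeff a f).
      by apply: additiveP => x y; rewrite mulrzBl.
    have [c cE] := choice cP; have [f f'|c' c'E] := @additiveP {freeg X} _ c.
      by apply: additive_ext => x; rewrite hom_subE !cE coeffB mulrzBr.
    by exists c' => f x; rewrite c'E cE.
  have [r rE] := tensor_bilinear_lift c.
  rewrite -[RHS](raddf0 r) -z0 !raddf_sum; apply: eq_bigr => j _.
  by rewrite tensor_mapE rE cE.
rewrite raddf_sum.
(* S collects the finite supports of all i k_j, so M is finite and coefficients outside S vanish. *)
pose S := undup (flatten [seq dom (i (k j)) | j <- enum 'I_n]).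
pose M := \matrix_(j < n, c < size S) coeff (tnth (in_tuple S) c) (i (k j)).
have [d d0 [N MNM]] := int_matrix_pseudo_inverse M.
have kd j : k j *~ d = \sum_l k l *~ (M *m N) j l.
  apply: i_inj; apply/eqP/freeg_eqP => a.
  rewrite raddfMz !raddf_sum raddfMz /=.
  have [aS|aS] := boolP (a \in S).
    pose c := Ordinal (etrans (index_mem a S) aS).
    have ca : tnth (in_tuple S) c = a by rewrite (tnth_nth a) nth_index.
    have /matrixP/(_ j c) := MNM; rewrite !mxE ca => kE.
    rewrite mulrzz mulrC -kE; apply: eq_bigr => x _.
    by rewrite !raddfMz /= mulrzz mulrC !mxE ca.
  have a0 x : coeff a (i (k x)) = 0.
    apply: coeff_outdom; apply: contra aS => ax; rewrite mem_undup.
    by apply/flatten_mapP; exists x; rewrite ?mem_enum.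
  by rewrite a0 mul0rz big1 // => x _; rewrite !raddfMz /= a0 mul0rz.
(* The values lie in Z, which is torsion-free, so the factor d can be cancelled. *)
suff : (\sum_j u (k j) (b j)) *~ d = 0.
  rewrite mulrzz => /eqP; rewrite mulf_eq0 (negbTE d0) orbF => /eqP s0.
  by rewrite -[RHS]s0; apply: eq_bigr => j _; rewrite lE.
have bM c : \sum_j b j *~ M j c = 0.
  by rewrite -[RHS](b0 (tnth (in_tuple S) c)); apply: eq_bigr => j _; rewrite mxE.
have bMN l' : \sum_j b j *~ (M *m N) j l' = 0.
  transitivity (\sum_c (\sum_j b j *~ M j c) *~ N c l').
    under [RHS]eq_bigr do rewrite mulrz_suml.
    rewrite exchange_big; apply: eq_bigr => j _; rewrite mxE mulrz_sumr.
    by apply: eq_bigr => c _; rewrite mulrzA.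
  by apply: big1 => c _; rewrite bM mul0rz.
rewrite mulrz_suml; transitivity (\sum_j \sum_l' u (k l') (b j *~ (M *m N) j l')).
  apply: eq_bigr => j _; rewrite -hom_mulzE -(raddfMz u) kd (raddf_sum u).
  by rewrite hom_sumE; apply: eq_bigr => l' _; rewrite (raddfMz u) hom_mulzE (raddfMz (u _)).
by rewrite exchange_big big1 // => l' _; rewrite -raddf_sum bMN raddf0.
Qed.

(** * Second isomorphism: passing to Ext(A (x) B, Z) *)

Section TensorExt.
Variables A B : zmodType.

Definition aug_tensor : {additive tensor {freeg A} B -> tensor A B} :=
  tensor_map (aug A) (hom_id B).

(** Quantifying over [l] stands in for the map K_A (x) B -> ker p, which [ker_aug_tensorP]
    constructs. *)
Definition tensor_rel_Ext (x : Ext A (dual B)) (y : Ext (tensor A B) int) : Prop :=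
  exists u (h : {additive ker aug_tensor -> int}) w,
    [/\ x = Ext_class A (dual B) u, y = Ext_class (tensor A B) int w,
        forall k b l, ker_incl aug_tensor l = tens (ker_incl (aug A) k) b -> h l = u k b
      & connecting h w].

Lemma aug_tensor_surj y : exists x, aug_tensor x = y.
Proof. exact/tensor_map_surj/aug_surj. Qed.

Lemma tensor_rel_ExtB x y x' y' :
  tensor_rel_Ext x y -> tensor_rel_Ext x' y' -> tensor_rel_Ext (x - x') (y - y').
Proof.
move=> [u [h [w [-> -> hu hw]]]] [u' [h' [w' [-> -> hu' hw']]]].
exists (u - u'), (h - h'), (w - w'); split; rewrite ?raddfB //; last exact: connectingB.
by move=> k b l lE; rewrite !hom_subE (hu k b l) // (hu' k b l).
Qed.

Lemma ker_aug_tensorP : exists q : {additive tensor (ker (aug A)) B -> ker aug_tensor},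
  (forall z, ker_incl aug_tensor (q z) = tensor_map (ker_incl (aug A)) (hom_id B) z)
  /\ forall l, exists z, q z = l.
Proof.
have [z|q qE] := @additive_corestrict _ _ _ aug_tensor
  (tensor_map (ker_incl (aug A)) (hom_id B)).
  apply: (tensor_hom_ext (u := hom_comp aug_tensor _) (v := hom_zero _ _)) => k b.
  rewrite hom_compE /aug_tensor !tensor_mapE ker_inclP.
  by have [t tE] := tensorP A B; rewrite -tE raddf0.
exists q; split=> // l.
have [z zE] := tensor_right_exact (@aug_surj A) (ker_inclP l).
by exists z; apply: ker_incl_inj; rewrite qE.
Qed.

Lemma tensor_rel_Ext_total x : exists y, tensor_rel_Ext x y.
Proof.
have [u ->] := Ext_class_surj x.
have [q [qE q_surj]] := ker_aug_tensorP.
have [l lE] := tensor_bilinear_lift u.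
(* The form l given by u kills the torsion kernel of [q], so it descends to ker p. *)
have [z z0|h hE] := additive_factor (h := l) q_surj.
  apply: (bilinear_vanishes_on_tor (@ker_incl_inj _ _ (aug A)) lE).
  by rewrite -qE z0 raddf0.
have [w hw] := connecting_total h aug_tensor_surj.
exists (Ext_class (tensor A B) int w), u, h, w; split=> // k b m mE.
rewrite -lE -hE; congr (h _); apply: ker_incl_inj.
by rewrite qE tensor_mapE.
Qed.

(** An extension of u to F_A x B gives a map on F_A (x) B; it extends h, because the images of the k
    (x) b generate ker p. *)
Lemma tensor_rel_Ext0 y : tensor_rel_Ext 0 y -> y = 0.
Proof.
move=> [u [h [w [/esym/Ext_class_eq0[t tE] -> hu hw]]]].
have [g gE] := tensor_bilinear_lift t.
apply: (extends_connecting0 (g := g) aug_tensor_surj hw) => l.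
have [q [qE q_surj]] := ker_aug_tensorP; have [z <-] := q_surj l; rewrite qE.
apply: (tensor_hom_ext (u := hom_comp g _) (v := hom_comp h q)) => k b.
rewrite !hom_compE tensor_mapE gE tE; apply/esym/hu.
by rewrite qE tensor_mapE.
Qed.

Lemma tensor_rel_Ext_surj y : whitehead B -> exists x, tensor_rel_Ext x y.
Proof.
move=> B0; have [w ->] := Ext_class_surj y.
have [h hw] := connecting_surj aug_tensor w (Ext_free_tensor B0).
have [q [qE q_surj]] := ker_aug_tensorP; have [t tE] := tensorP (ker (aug A)) B.
pose u := hom_comp (postcomp B (hom_comp h q)) t.
exists (Ext_class A (dual B) u), u, h, w; split=> // k b l lE.
rewrite /u /= tE; congr (h _); apply: ker_incl_inj.
by rewrite qE tensor_mapE.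
Qed.

Lemma tensor_rel_Ext_inj x : tensor_rel_Ext x 0 -> x = 0.
Proof.
move=> [u [h [w [-> w0 hu hw]]]].
have [g gE] := connecting0_extends hw (esym w0).
have [t tE] := tensorP {freeg A} B.
apply/Ext_class_eq0; exists (hom_comp (postcomp B g) t) => k.
apply: additive_ext => b; rewrite /= tE.
have [q [qE _]] := ker_aug_tensorP.
have kb : ker_incl aug_tensor (q (tens k b)) = tens (ker_incl (aug A) k) b.
  by rewrite qE tensor_mapE.
by rewrite -(hu k b _ kb) -gE kb.
Qed.

End TensorExt.

Lemma tensor_rel_Ext_natural (A A' B B' : zmodType)
    (f : {additive A' -> A}) (g : {additive B' -> B}) x y :
  tensor_rel_Ext x y ->
  tensor_rel_Ext (Ext_map f (dual_map g) x) (Ext_map (tensor_map f g) (hom_id int) y).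
Proof.
move=> [u [h [w [-> -> hu hw]]]].
have sq e : aug_tensor A B (tensor_map (free_map f) g e) = tensor_map f g (aug_tensor A' B' e).
  apply: (tensor_hom_ext (u := hom_comp (aug_tensor A B) _)
                         (v := hom_comp _ (aug_tensor A' B'))) => d b.
  by rewrite !hom_compE /aug_tensor !tensor_mapE free_map_aug.
exists (hom_comp (dual_map g) (hom_comp u (syzygy_map f))), (hom_comp h (ker_map sq)).
exists (hom_comp w (syzygy_map (tensor_map f g))).
split; rewrite ?Ext_mapE //; last exact: connecting_natural.
  by congr (Ext_class _ _ _); apply: additive_ext.
move=> k b l lE; rewrite !hom_compE; apply: hu.
by rewrite ker_mapE lE tensor_mapE.
Qed.

Theorem theorem2p2 :
  (exists phi : forall A B : wgroup, {additive Ext A (dual B) -> Ext B (dual A)},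
     (forall A B : wgroup, bijective (phi A B)) /\
     (forall (A A' B B' : wgroup)
             (f : {additive A' -> A}) (g : {additive B' -> B})
             (x : Ext A (dual B)),
        phi A' B' (Ext_map f (dual_map g) x) =
        Ext_map g (dual_map f) (phi A B x)))
  /\
  (exists psi : forall A B : wgroup, {additive Ext A (dual B) -> Ext (tensor A B) int},
     (forall A B : wgroup, bijective (psi A B)) /\
     (forall (A A' B B' : wgroup)
             (f : {additive A' -> A}) (g : {additive B' -> B})
             (x : Ext A (dual B)),
        psi A' B' (Ext_map f (dual_map g) x) =
        Ext_map (tensor_map f g) (hom_id int) (psi A B x))).
Proof.
split.
  (* [cid] turns existence into data. Keeping the equivalence with the relation reduces naturality
     of the chosen map to that of [swap_rel]. *)
  have phiP (A B : wgroup) : {phi : {additive Ext A (dual B) -> Ext B (dual A)} |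
      bijective phi /\ forall x y, swap_rel x y <-> phi x = y}.
    apply: cid; have [|||||phi] := @additive_relation_bij _ _ (@swap_rel A B).
    - exact: swap_relB.
    - by move=> x; apply/swap_rel_total/wgroupP.
    - exact: swap_rel0.
    - move=> y; have [x yx] := swap_rel_total y (@wgroupP B).
      by exists x; apply: swap_rel_sym.
    - by move=> x x0; apply/swap_rel0/swap_rel_sym.
    by exists phi.
  exists (fun A B => sval (phiP A B)); split=> [A B|A A' B B' f g x].
    by case: (svalP (phiP A B)).
  have [_ phiE] := svalP (phiP A B); have [_ phiE'] := svalP (phiP A' B').
  by apply/phiE'/swap_rel_natural/phiE.
have psiP (A B : wgroup) : {psi : {additive Ext A (dual B) -> Ext (tensor A B) int} |
    bijective psi /\ forall x y, tensor_rel_Ext x y <-> psi x = y}.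
  apply: cid; have [|||||psi] := @additive_relation_bij _ _ (@tensor_rel_Ext A B).
  - exact: tensor_rel_ExtB.
  - exact: tensor_rel_Ext_total.
  - exact: tensor_rel_Ext0.
  - by move=> y; apply/tensor_rel_Ext_surj/wgroupP.
  - exact: tensor_rel_Ext_inj.
  by exists psi.
exists (fun A B => sval (psiP A B)); split=> [A B|A A' B B' f g x].
  by case: (svalP (psiP A B)).
have [_ psiE] := svalP (psiP A B); have [_ psiE'] := svalP (psiP A' B').
by apply/psiE'/tensor_rel_Ext_natural/psiE.
Qed.
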